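(* Let $k\ge 2$ be an integer and let $f=\sum_{n=0}^\infty f_n\chi_n$ be a radial function on the free group $\mathbb{F}_k$ with $f_n\ge 0$ for all $n$. Then the operator $\lambda(f)$ is of restricted weak type $(2,2)$ if and only if $f\in L^{(2,1)}(\mathbb{F}_k)$.
   Context: $\mathbb{F}_k$ is the free group on $k\ge2$ free generators. The length $|x|$ of $x\in\mathbb{F}_k$ is the number of letters in its reduced form as a word in the generators and their inverses. $\chi_n$ is the indicator function of the set of elements of length $n$. The group carries counting measure. For a function $f$ on $\mathbb{F}_k$, $\lambda(f)$ is the left convolution operator $\lambda(f)g=f*g$, $(f*g)(x)=\sum_y f(xy^{-1})g(y)$. For $1<p<\infty$, $p'=p/(p-1)$, weak $L^p$ is $L^{(p,\infty)}=\{h:\sup_{t>0}t^p|\{x:|h(x)|>t\}|<\infty\}$, and $L^{(p,1)}$ is the Lorentz space which is the predual of $L^{(p',\infty)}$ with respect to the standard inner product. Concretely, $h\in L^{(p,1)}(\mathbb{F}_k)$ iff $\sum_{j\ge1}j^{1/p-1}h^*(j)<\infty$, where $h^*$ is the decreasing rearrangement of $|h|$. A linear operator $T$ is of restricted weak type $(p,p)$ if it maps $L^{(p,1)}$ boundedly into $L^{(p,\infty)}$; equivalently, $$\|T\|_{(p,1)\to(p,\infty)}=\sup_{E,F}\frac{|\langle T\chi_E,\chi_F\rangle|}{|E|^{1/p}|F|^{1/p'}}<\infty,$$ the supremum being over finite nonempty subsets $E,F$ with indicator functions $\chi_E,\chi_F$. *)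

(* Defs.v *)
From HB Require Import structures.
From mathcomp Require Import all_boot all_order all_algebra.
From mathcomp Require Import complex.
From mathcomp Require Import all_classical all_reals all_analysis.
From mathcomp Require summability.

Set Implicit Arguments.
Unset Strict Implicit.
Unset Printing Implicit Defensive.

Import Order.TTheory GRing.Theory Num.Theory.
Import numFieldNormedType.Exports.

Local Open Scope classical_set_scope.
Local Open Scope ring_scope.
Local Open Scope complex_scope.

Section FreeGroup.
Variable k : nat.

(* [(i, false)] is the [i]-th generator and [(i, true)] its inverse. *)
Definition letter : Type := 'I_k * bool.
HB.instance Definition _ := Countable.on letter.

Definition letter_inv (a : letter) : letter := (a.1, ~~ a.2).

Definition reduced (w : seq letter) : bool :=
  sorted [rel a b | b != letter_inv a] w.

Record free_group := FreeGroup { word : seq letter; _ : reduced word }.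
HB.instance Definition _ := [isSub for word].
HB.instance Definition _ := [Countable of free_group by <:].

Definition push (a : letter) (w : seq letter) : seq letter :=
  if w is b :: w' then if b == letter_inv a then w' else a :: w else [:: a].

Definition reduce (w : seq letter) : seq letter := foldr push [::] w.

Definition inv_word (w : seq letter) : seq letter := rev (map letter_inv w).

Lemma letter_invK : involutive letter_inv.
Proof. by case=> i b; rewrite /letter_inv /= negbK. Qed.

Lemma reduced_cons a w : reduced (a :: w) -> reduced w.
Proof. exact: path_sorted. Qed.

Lemma reduced_push a w : reduced w -> reduced (push a w).
Proof.
case: w => [//|b w] /= rw; case: eqVneq => [_|ba]; first exact: reduced_cons rw.
by rewrite /reduced /= ba.
Qed.

Lemma reduced_foldr u s : reduced s -> reduced (foldr push s u).
Proof. by move=> rs; elim: u => //= a u; exact: reduced_push. Qed.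

Lemma pushK a s : reduced s -> push a (push (letter_inv a) s) = s.
Proof.
case: s => [_|b s rs] /=; first by rewrite eqxx.
rewrite letter_invK; case: eqVneq => [ba|_ /=]; last by rewrite eqxx.
rewrite {b}ba in rs *.
by case: s rs => [//|c s] /= /andP[/negPf ->].
Qed.

Lemma reduce_id w : reduced w -> reduce w = w.
Proof.
elim: w => // a w IHw rw /=; rewrite -/(reduce w) IHw; last exact: reduced_cons rw.
by case: w rw {IHw} => //= b w /andP[/negPf ->].
Qed.

Lemma foldr_reduce u s : reduced s -> foldr push s (reduce u) = foldr push s u.
Proof.
move=> rs; elim: u => //= a u <-; rewrite -/(reduce u).
have : reduced (reduce u) by exact: reduced_foldr.
case: (reduce u) => //= b w rw.
case: eqVneq => //= ->; rewrite pushK //.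
exact: reduced_foldr.
Qed.

Lemma reduced_reduce w : reduced (reduce w).
Proof. exact: reduced_foldr. Qed.

Lemma reduced_inv w : reduced w -> reduced (inv_word w).
Proof.
rewrite /reduced /inv_word rev_sorted sorted_map; apply: sub_sorted => a b /=.
by rewrite letter_invK eq_sym.
Qed.

Lemma reduced_word (x : free_group) : reduced (word x).
Proof. exact: valP x. Qed.

Definition fg_one : free_group := @FreeGroup [::] isT.
Definition fg_mul (x y : free_group) : free_group :=
  FreeGroup (reduced_reduce (word x ++ word y)).
Definition fg_inv (x : free_group) : free_group :=
  FreeGroup (reduced_inv (reduced_word x)).

Lemma fg_mulA : associative fg_mul.
Proof.
move=> x y z; apply: val_inj => /=.
have redE u v : reduce (u ++ v) = foldr push (reduce v) u by exact: foldr_cat.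
rewrite [in LHS]redE reduce_id ?reduced_reduce // [RHS]redE.
by rewrite foldr_reduce ?reduced_reduce // redE foldr_cat.
Qed.

Lemma fg_mul1 : left_id fg_one fg_mul.
Proof. by move=> x; apply: val_inj; exact: reduce_id (reduced_word x). Qed.

Lemma fg_mulr1 : right_id fg_one fg_mul.
Proof.
by move=> x; apply: val_inj; rewrite /= cats0; exact: reduce_id (reduced_word x).
Qed.

Lemma fg_mulV : left_inverse fg_one fg_inv fg_mul.
Proof.
move=> x; apply: val_inj => /=.
rewrite /reduce foldr_cat -/(reduce (word x)) (reduce_id (reduced_word x)).
elim: (word x) => //= a w IHw.
by rewrite /inv_word /= rev_cons foldr_rcons /= letter_invK eqxx.
Qed.

Lemma fg_invK : involutive fg_inv.
Proof.
move=> x; apply: val_inj; rewrite /= /inv_word map_rev revK.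
by rewrite -map_comp map_id_in // => a _; exact: letter_invK.
Qed.

Lemma fg_mulrV : right_inverse fg_one fg_inv fg_mul.
Proof. by move=> x; rewrite -{1}[x]fg_invK fg_mulV. Qed.

HB.instance Definition _ :=
  isGroup.Build free_group fg_mulA fg_mul1 fg_mulr1 fg_mulV fg_mulrV.

Definition fg_length (x : free_group) : nat := size (word x).

Definition sphere (n : nat) : set free_group := [set x | fg_length x = n].

End FreeGroup.

Section Lorentz.
Context {R : realType} {T : choiceType}.
Implicit Types (h : T -> R[i]) (p t : R).
Local Open Scope ereal_scope.

(* In [R[i]], [t%:C < z] says that [z] is a real number greater than [t]. *)
Definition distribution_function h t : \bar R :=
  counting [set x | (t%:C < `|h x|)%R].

(* Sequence indexed from 1; it takes the value [+oo] when [h] is unbounded. *)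
Definition rearrangement h (j : nat) : \bar R :=
  ereal_inf [set t%:E | t in [set t : R | (0 <= t)%R /\
                                          distribution_function h t < j%:R%:E]].

Definition lorentz_norm p h : \bar R :=
  \sum_(1 <= j <oo) (j%:R `^ (p^-1 - 1))%:E * rearrangement h j.

Definition lorentz p : set (T -> R[i]) := [set h | lorentz_norm p h < +oo].

Definition weak_norm p h : \bar R :=
  (ereal_sup [set (t `^ p)%:E * distribution_function h t |
                t in [set t : R | (0 < t)%R]]) `^ p^-1.

(* [Op] is an operator given on the domain [D]. The target space, weak L^p, is
   the set of functions of finite [weak_norm p], so the bound also says that
   [Op] maps [lorentz p] into it. *)
Definition restricted_weak_type p (D : set (T -> R[i]))
    (Op : (T -> R[i]) -> (T -> R[i])) : Prop :=
  lorentz p `<=` D /\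
  exists M : R, forall h, lorentz p h ->
    weak_norm p (Op h) <= M%:E * lorentz_norm p h.

End Lorentz.

Section Convolution.
Context {R : realType} {G : groupType}.
Implicit Types f g : G -> R[i].

(* The terms of the sum over [y] defining [(f * g) x]; the regular algebra
   [R[i]^o] carries the usual topology of the complex numbers. *)
Definition convolution_term f g (x y : G) : R[i]^o := f (x * y^-1)%g * g y.

(* The functions [g] for which every sum defining [f * g] converges
   unconditionally. *)
Definition convolution_domain f : set (G -> R[i]) :=
  [set g | forall x,
     cvg (summability.partial_sum (convolution_term f g x) @ summability.totally)].

Definition convolution f g : G -> R[i] :=
  fun x => summability.sum (convolution_term f g x).

End Convolution.

(* Main.v *)
Require Import Defs.
From HB Require Import structures.
From mathcomp Require Import all_boot all_order all_algebra.
From mathcomp Require Import complex finmap.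
From mathcomp Require Import all_classical all_reals all_analysis.
From mathcomp Require Import zify ring lra.
From mathcomp Require summability.
Import Order.TTheory GRing.Theory Num.Theory.
Import numFieldNormedType.Exports.
Local Open Scope classical_set_scope.
Local Open Scope ring_scope.
Local Open Scope complex_scope.

(** Put [q = 2 k - 1] and [r = sqrt q]; the sphere of radius [n] has between [q ^ n]
    and [2 q ^ n] elements. Both sides of the equivalence amount to the
    convergence of the series of general term [f_ n * r ^ n].

    For the Lorentz norm, one direction pairs [f] with the weight [r ^- |x|],
    which is in the weak space (2,oo) ([lorentz_series]). The other bounds the
    [j]-th value of the rearrangement of [f] by the sum of the [f_ m] over the
    radii [m] whose ball has at least [j] elements ([series_lorentz]).

    For the operator, the point is the estimate [pairs_sqrt]: the number of pairs
    [(x, y)] in [F * E] such that [x y^-1] has length [n] is at most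
    [8 r ^ n sqrt |F| sqrt |E|]. Write [x = u w] and [y = v w] with [w] the longest
    common suffix, [|u| = i] and [|v| = n - i]. For given [i] there are at most
    [min (2 |F| q ^ (n - i), 2 |E| q ^ i)] such pairs, and the sum of these minima
    over [i] is dominated by two geometric series around its largest term, so no
    factor [n] is lost. Summing over [n] with weights [f_ n] gives the restricted
    estimate for indicators; [sum_weight_le_lorentz], a summation by parts along
    the decreasing rearrangement, extends it to the whole Lorentz space
    ([series_restricted]). Conversely, the convolution of [f] with the indicator of
    the ball of radius [N] is bounded below, on the sphere of radius [N], by a
    constant times the partial sum of the series up to [N] ([restricted_series],
    from the count [pairs_ge]). *)

(** * Counting reduced words *)

Section Combinatorics.
Set Implicit Arguments.
Unset Strict Implicit.
Local Open Scope nat_scope.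

Lemma leq_size_code (T U : eqType) (t : seq T) (f : T -> U) (s : seq U) :
    uniq t -> {in t &, injective f} -> {in t, forall x, f x \in s} ->
  size t <= size s.
Proof.
move=> ut finj ft; rewrite -(size_map f); apply: uniq_leq_size.
  by rewrite map_inj_in_uniq.
by move=> _ /mapP[x xA ->]; exact: ft.
Qed.

Lemma geq_size_code (T U : eqType) (t : seq T) (f : T -> U) (s : seq U) :
  uniq s -> {in s, forall w, exists2 x, x \in t & f x = w} -> size s <= size t.
Proof.
move=> us fs; rewrite -(size_map f t); apply: uniq_leq_size => // w /fs[x xA <-].
exact: map_f.
Qed.

Variable k : nat.
Hypothesis k2 : 1 < k.
Notation letter := (letter k).
Notation G := (free_group k).
Implicit Types (a b c : letter) (u v w : seq letter) (x y : G).

Let r : rel letter := [rel a b | b != letter_inv a].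

(** Each reduced word has [degree] reduced extensions by one letter: the Cayley
    tree of the group is regular of valency [degree.+1 = k.*2]. *)
Definition degree := (k.*2).-1.
Notation q := degree.

Lemma degree_ge3 : 3 <= q. Proof. rewrite /degree; lia. Qed.

(** The words of length [n] that can follow the letter [a] in a reduced word. *)
Fixpoint extensions n a : seq (seq letter) :=
  if n is m.+1 then
    [seq b :: w | b <- [seq b <- enum {: letter} | r a b], w <- extensions m b]
  else [:: [::]].

Lemma mem_extensions n a w :
  (w \in extensions n a) = (size w == n) && path r a w.
Proof.
elim: n a w => [|n IHn] a w /=; first by case: w.
apply/allpairsPdep/idP => [[b [v []]]|].
  rewrite mem_filter mem_enum IHn => /andP[ab _] /andP[/eqP <- bv] -> /=.
  by rewrite eqxx bv andbT.
case: w => // b w /andP[/= sw /andP[ab bw]]; exists b, w; split=> //.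
  by rewrite mem_filter mem_enum andbT.
by rewrite IHn bw andbT.
Qed.

Lemma extensions_uniq n a : uniq (extensions n a).
Proof.
elim: n a => //= n IHn a; apply: allpairs_uniq_dep.
- by rewrite filter_uniq // enum_uniq.
- by move=> b _; exact: IHn.
- by move=> [b w] [c v] _ _ /= [-> ->].
Qed.

Lemma size_extensions n a : size (extensions n a) = q ^ n.
Proof.
elim: n a => //= n IHn a; rewrite size_allpairs_dep.
rewrite (eq_map IHn) sumnE big_map big_const_seq count_predT iter_addn_0 expnSr.
congr (_ * _); have -> : q = #|predC1 (letter_inv a)|.
  by rewrite cardC1 card_prod card_ord card_bool muln2.
by rewrite cardE enumT; congr size; apply: eq_filter => b; rewrite !inE.
Qed.

(** The reduced words of length [n]. *)
Definition words n : seq (seq letter) :=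
  if n is m.+1 then [seq b :: w | b <- enum {: letter}, w <- extensions m b]
  else [:: [::]].

Lemma mem_words n w : (w \in words n) = (size w == n) && reduced w.
Proof.
case: n => [|n] /=; first by case: w.
apply/allpairsPdep/idP => [[b [v []]]|].
  by rewrite mem_extensions => _ /andP[/eqP <- bv] -> /=; rewrite eqxx.
case: w => // b w /andP[/= sw bw]; exists b, w; split=> //.
  by rewrite mem_enum.
by rewrite mem_extensions bw andbT.
Qed.

Lemma words_uniq n : uniq (words n).
Proof.
case: n => //= n; apply: allpairs_uniq_dep.
- exact: enum_uniq.
- by move=> b _; exact: extensions_uniq.
- by move=> [b w] [c v] _ _ /= [-> ->].
Qed.

Lemma size_words n : size (words n.+1) = k.*2 * q ^ n.
Proof.
rewrite /= size_allpairs_dep (eq_map (size_extensions n)) sumnE big_map.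
rewrite big_const_seq count_predT iter_addn_0 mulnC; congr (_ * _).
by rewrite -cardE card_prod card_ord card_bool muln2.
Qed.

Lemma size_words_ge n : q ^ n <= size (words n).
Proof.
case: n => // n; rewrite size_words expnS leq_mul2r; apply/orP; right.
rewrite /degree; lia.
Qed.

Lemma size_words_le n : size (words n) <= 2 * q ^ n.
Proof.
case: n => // n; rewrite size_words expnS mulnA leq_mul2r; apply/orP; right.
rewrite /degree; lia.
Qed.

(** The sphere of radius [n] and the ball of radius [N] around the identity, as
    finite sets. *)
Definition fsphere n : {fset G} := [fset x in pmap insub (words n)]%fset.

Lemma in_fsphere n x : (x \in fsphere n) = (fg_length x == n).
Proof.
rewrite inE mem_pmap_sub mem_words /fg_length.
by have := reduced_word x; rewrite /= => ->; rewrite andbT.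
Qed.

Lemma card_fsphere n : #|` fsphere n| = size (words n).
Proof.
apply/eqP; rewrite eqn_leq; apply/andP; split.
  apply: (@leq_size_code _ _ _ (@word k)); first exact: fset_uniq.
    by move=> x y _ _; exact: val_inj.
  move=> x; rewrite in_fsphere mem_words => ->; exact: reduced_word.
apply: (@geq_size_code _ _ _ (@word k)); first exact: words_uniq.
move=> w; rewrite mem_words => /andP[sw rw].
by exists (FreeGroup rw); rewrite ?in_fsphere.
Qed.

Definition fball N : {fset G} :=
  [fset x in flatten [seq (fsphere n : seq G) | n <- iota 0 N.+1]]%fset.

Lemma in_fball N x : (x \in fball N) = (fg_length x <= N).
Proof.
rewrite in_fset; apply/flatten_mapP/idP => [[n]|xN].
  by rewrite mem_iota in_fsphere => nN /eqP ->; lia.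
by exists (fg_length x); rewrite ?mem_iota ?in_fsphere //; lia.
Qed.

Lemma card_fball N : #|` fball N| <= 3 * q ^ N.
Proof.
apply: (@leq_trans (\sum_(n < N.+1) #|` fsphere n|)).
  rewrite card_fseq (leq_trans (size_undup _)) // size_flatten sumnE big_map.
  by rewrite big_map -(big_mkord xpredT (fun n => #|` fsphere n|)).
elim: N => [|N IHN]; first by rewrite big_ord_recr big_ord0 card_fsphere.
rewrite big_ord_recr /= card_fsphere.
apply: leq_trans (leq_add IHN (size_words_le N.+1)) _.
rewrite expnS; have := degree_ge3; nia.
Qed.

(** * Lengths of quotients *)

Lemma word_mul x y : reduced (word x ++ word y) ->
  word (x * y)%g = word x ++ word y.
Proof. exact: reduce_id. Qed.

Lemma reduced_catl u v : reduced (u ++ v) -> reduced u.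
Proof. by case: u => //= a u; rewrite /reduced /= cat_path => /andP[]. Qed.

Lemma reduced_catr u v : reduced (u ++ v) -> reduced v.
Proof.
elim: u => //= a u IHu; rewrite /reduced /= => /path_sorted; exact: IHu.
Qed.

Lemma size_inv_word u : size (inv_word u) = size u.
Proof. by rewrite size_rev size_map. Qed.

Lemma inv_wordK : involutive (@inv_word k).
Proof.
move=> u; rewrite /inv_word map_rev revK -map_comp map_id_in // => a _.
exact: letter_invK.
Qed.

(** If [x = u w] and [y = v w] with no cancellation between [u] and the inverse
    of [v], then the quotient of [x] by [y] has length [|u| + |v|]. *)
Lemma length_divg x y u v w : word x = u ++ w -> word y = v ++ w ->
  reduced (u ++ inv_word v) -> fg_length (x * y^-1)%g = size u + size v.
Proof.
move=> xE yE ruv.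
have rx := reduced_word x; have ry := reduced_word y; rewrite xE yE in rx ry.
pose U := FreeGroup (reduced_catl rx); pose V := FreeGroup (reduced_catl ry).
pose W := FreeGroup (reduced_catr rx).
have -> : x = (U * W)%g by apply: val_inj; rewrite /= reduce_id.
have -> : y = (V * W)%g by apply: val_inj; rewrite /= reduce_id.
rewrite invgM mulgA mulgK /fg_length word_mul ?size_cat //=.
by rewrite size_inv_word.
Qed.

(** Removing the longest common suffix leaves no cancellation. *)
Lemma split_divg u v : reduced u -> reduced v -> exists u' v' w,
  [/\ u = u' ++ w, v = v' ++ w & reduced (u' ++ inv_word v')].
Proof.
elim/last_ind: u v => [|u a IHu] v.
  move=> _ rv; exists [::], v, [::]; split; rewrite ?cats0 //.
  exact: reduced_inv.
elim/last_ind: v => [|v b _] ru rv.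
  by exists (rcons u a), [::], [::]; rewrite ?cats0.
have [ab|ab] := eqVneq a b.
  have ru' : reduced u by move: ru; rewrite -cats1 => /reduced_catl.
  have rv' : reduced v by move: rv; rewrite -cats1 => /reduced_catl.
  have [u' [v' [w [-> -> ruv]]]] := IHu v ru' rv'.
  by exists u', v', (rcons w a); rewrite -!rcons_cat ab.
exists (rcons u a), (rcons v b), [::]; split; rewrite ?cats0 //.
have := reduced_inv rv; rewrite /inv_word map_rcons rev_rcons.
move: ru; rewrite /reduced; case: u {IHu} => [|c u] /=.
  by move=> _ ->; rewrite andbT (inj_eq (can_inj (@letter_invK k))) eq_sym.
rewrite cat_path => -> /=; rewrite last_rcons => ->.
by rewrite andbT (inj_eq (can_inj (@letter_invK k))) eq_sym.
Qed.

(** Removing the first [i] letters of [x] and the first [j] letters of [y] leaves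
    the same word. *)
Definition same_tail i j x y :=
  [&& i <= fg_length x, j <= fg_length y & drop i (word x) == drop j (word y)].

Lemma same_tail_divg n x y : fg_length (x * y^-1)%g = n ->
  exists i : 'I_n.+1, same_tail i (n - i) x y.
Proof.
move=> <-.
have [u [v [w [xE yE ruv]]]] := split_divg (reduced_word x) (reduced_word y).
rewrite (length_divg xE yE ruv).
have iP : size u < (size u + size v).+1 by lia.
exists (Ordinal iP) => /=; rewrite /same_tail addKn /fg_length xE yE !size_cat.
by rewrite !leq_addr !drop_size_cat //=.
Qed.

Lemma same_tailC i j x y : same_tail i j x y = same_tail j i y x.
Proof. by rewrite /same_tail eq_sym andbCA. Qed.

Lemma sum_bool (T : Type) (s : seq T) (P : pred T) :
  \sum_(y <- s) (P y : nat) = count P s.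
Proof. by rewrite -sumn_count sumnE big_map. Qed.

Lemma card_same_tail i j x (E : {fset G}) :
  \sum_(y <- E) same_tail i j x y <= 2 * q ^ j.
Proof.
apply: leq_trans (size_words_le j); rewrite sum_bool -size_filter.
apply: (@leq_size_code _ _ _ (fun y => take j (word y))).
- exact: filter_uniq (fset_uniq E).
- move=> y z; rewrite !mem_filter => /andP[/and3P[_ _ /eqP xy] _].
  move=> /andP[/and3P[_ _ /eqP xz] _] yz; apply: val_inj => /=.
  by rewrite -(cat_take_drop j (word y)) -xy xz yz cat_take_drop.
move=> y; rewrite mem_filter => /andP[/and3P[_ jy _] _].
rewrite mem_words size_takel // eqxx /=.
by apply: (@reduced_catl _ (drop j (word y))); rewrite cat_take_drop reduced_word.
Qed.

(** The number of pairs in [F] and [E] whose quotient has length [n], that is,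
    the pairing of the indicator of [F] with the convolution of the indicator of
    the sphere of radius [n] with that of [E]. *)
Definition pairs n (F E : {fset G}) :=
  \sum_(x <- F) \sum_(y <- E) (fg_length (x * y^-1)%g == n).

(** Sort the pairs by the number [i] of letters of [x] before the common suffix:
    once [i] is fixed, [x] leaves at most [2 * q ^ (n - i)] choices for [y] and
    [y] at most [2 * q ^ i] choices for [x]. *)
Lemma pairs_le n F E :
  pairs n F E <= \sum_(i < n.+1)
    minn (#|` F| * (2 * q ^ (n - i))) (#|` E| * (2 * q ^ i)).
Proof.
apply: (@leq_trans (\sum_(i < n.+1) \sum_(x <- F) \sum_(y <- E)
    same_tail i (n - i) x y)).
  rewrite exchange_big /=; apply: leq_sum => x _.
  rewrite exchange_big /=; apply: leq_sum => y _.
  case: eqP => // /same_tail_divg[i iP].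
  by rewrite (bigD1 i) //= iP.
apply: leq_sum => i _; rewrite leq_min; apply/andP; split.
  apply: leq_trans (leq_sum _ (fun x _ => card_same_tail i (n - i) x E)) _.
  by rewrite big_const_seq count_predT iter_addn_0 mulnC.
rewrite exchange_big /=.
apply: (@leq_trans (\sum_(y <- E) 2 * q ^ i)).
  apply: leq_sum => y _; under eq_bigr do rewrite same_tailC; exact: card_same_tail.
by rewrite big_const_seq count_predT iter_addn_0 mulnC.
Qed.

Lemma reduced_rcons_cons u a b v : reduced (rcons u a) -> reduced (b :: v) ->
  b != letter_inv a -> reduced (rcons u a ++ b :: v).
Proof.
case: u => [|c u]; rewrite /reduced /= => ru rv ab; first by rewrite ab.
by rewrite cat_path ru /= last_rcons ab.
Qed.

Lemma avoid_two a b : exists c, (c != a) && (c != b).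
Proof.
apply/existsP; apply: contraT; rewrite negb_exists => /forallP ab.
have : size (enum {: letter}) <= size [:: a; b].
  apply: uniq_leq_size (enum_uniq _) _ => c _; rewrite !inE.
  by have := ab c; rewrite negb_and !negbK.
by rewrite -cardE card_prod card_ord card_bool /=; lia.
Qed.

(** On the sphere of radius [N], the convolution of the sphere of radius [n] with
    the ball of radius [N] is at least of the order of [q ^ n./2]. *)
Lemma pairs_ge N n x : fg_length x = N -> n <= N.*2 ->
  q ^ (n./2).-1 <= \sum_(y <- fball N) (fg_length (x * y^-1)%g == n).
Proof.
move=> xN nN; rewrite sum_bool -size_filter.
(* Write [x = u w] with [|u| = uphalf n], and look for [y = v w] with
   [|v| = n./2]. *)
pose i := uphalf n; have iN : i <= N by rewrite /i; lia.
have rx := reduced_word x; rewrite -(cat_take_drop i (word x)) in rx.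
have su : size (take i (word x)) = i by rewrite size_takel // -/(fg_length x) xN.
have ru := reduced_catl rx; have rw := reduced_catr rx.
have sw : size (drop i (word x)) = N - i by rewrite size_drop -xN.
case jE : n./2 => [|m] /=.
  have wP : FreeGroup rw \in [seq y <- fball N | fg_length (x * y^-1)%g == n].
    rewrite mem_filter in_fball [fg_length (FreeGroup rw)]sw leq_subr andbT; apply/eqP.
    rewrite (@length_divg _ _ (take i (word x)) [::] (drop i (word x))).
    - by rewrite su /i /=; lia.
    - by rewrite cat_take_drop.
    - by [].
    - by rewrite cats0.
  by case: [seq y <- _ | _] wP.
have [u' [a uE]] : exists u' a, take i (word x) = rcons u' a.
  case/lastP: (take i _) su => [/= i0|u' a _]; last by exists u', a.
  by move: i0; rewrite /i; lia.
(* [d] is the first letter of the inverse of the new prefix [v]: with this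
   choice, neither [u] times the inverse of [v] nor [v w] has a cancellation,
   whatever the other letters of [v]. *)
have [d [dP dw]] : exists d, d != letter_inv a /\
    forall s, reduced (d :: s) -> reduced (inv_word (d :: s) ++ drop i (word x)).
  case wE : (drop i (word x)) rw => [|b w] rw.
    have [d /andP[da _]] := avoid_two (letter_inv a) a.
    by exists d; split=> // s rs; rewrite cats0; exact: reduced_inv.
  have [d /andP[da db]] := avoid_two (letter_inv a) b.
  exists d; split=> // s rs; have := reduced_inv rs.
  rewrite /inv_word map_cons rev_cons => rs'; apply: reduced_rcons_cons => //.
  by rewrite letter_invK eq_sym.
rewrite -(size_extensions m d).
apply: (@geq_size_code _ _ _ (fun y => behead (inv_word (take m.+1 (word y))))).
  exact: extensions_uniq.
move=> s; rewrite mem_extensions => /andP[/eqP ss rds'].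
have rds : reduced (d :: s) := rds'.
have sv : size (inv_word (d :: s)) = m.+1 by rewrite size_inv_word /= ss.
have rv := dw s rds; exists (FreeGroup rv); last first.
  rewrite /= takel_cat ?sv // take_oversize ?sv //.
  by rewrite inv_wordK.
have yN : fg_length (FreeGroup rv) = m.+1 + (N - i).
  by rewrite /fg_length /= size_cat sv sw.
rewrite mem_filter in_fball yN.
apply/andP; split; last by rewrite /i; lia.
rewrite (@length_divg _ _ (take i (word x)) (inv_word (d :: s)) (drop i (word x))).
- by rewrite su sv /i; lia.
- by rewrite cat_take_drop.
- by [].
rewrite inv_wordK uE.
by apply: reduced_rcons_cons => //; rewrite -uE.
Qed.

End Combinatorics.

(** * Real inequalities *)

Section Inequalities.
Set Implicit Arguments.
Unset Strict Implicit.
Variable R : realType.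
Implicit Types (q rho : R).

(** The terms decay geometrically on both sides of the index where [q ^+ i]
    passes [rho], so the sum is bounded independently of [n] and [rho]. The
    bound is shaped for the induction that replaces [rho] by [rho / q]. *)
Lemma sum_min_geometric q rho n : 2 <= q -> 0 < rho ->
  \sum_(i < n) Num.min (rho / q ^+ i) (q ^+ i / rho)
    <= if rho <= 1 then 2 * rho else 4 - rho^-1.
Proof.
move=> q2; have q0 : 0 < q by lra.
elim: n rho => [|n IHn] rho rho0.
  rewrite big_ord0; case: ifPn => [_|]; first lra.
  by rewrite -ltNge -invf_lt1 // => ?; lra.
rewrite big_ord_recl expr0 divr1 mul1r.
rewrite (eq_bigr (fun i : 'I_n =>
    Num.min (rho / q / q ^+ i) (q ^+ i / (rho / q)))); last first.
  move=> i _; rewrite lift0 exprS.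
  have qi0 : q ^+ i != 0 by rewrite expf_neq0 ?gt_eqF.
  have -> : rho / (q * q ^+ i) = rho / q / q ^+ i by field; rewrite qi0 gt_eqF.
  by have -> : q * q ^+ i / rho = q ^+ i / (rho / q) by field; rewrite !gt_eqF.
have := IHn (rho / q) (divr_gt0 rho0 q0).
have qV : q^-1 <= 2^-1 by rewrite lef_pV2 ?posrE //; lra.
have rq : rho / q <= rho / 2 by rewrite ler_pM2l.
have r0 : 0 < rho^-1 by rewrite invr_gt0.
have rr : rho * rho^-1 = 1 by rewrite mulfV ?gt_eqF.
have m1 : Num.min rho rho^-1 <= rho by rewrite ge_min lexx.
have m2 : Num.min rho rho^-1 <= rho^-1 by rewrite ge_min lexx orbT.
have [rho1|rho1] := leP rho 1.
  have -> : rho / q <= 1 by lra.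
  move=> H; lra.
have ri1 : rho^-1 < 1 by rewrite invf_lt1.
have [rq1|rq1] := leP (rho / q) 1.
  move=> H; lra.
rewrite invfM invrK => H.
have : rho^-1 * 2 <= rho^-1 * q by rewrite ler_pM2l.
lra.
Qed.

Lemma sqrt_succ_sub (N : nat) :
  Num.sqrt N.+1%:R - Num.sqrt N%:R <= (Num.sqrt N.+1%:R)^-1 :> R.
Proof.
set t := Num.sqrt N.+1%:R; set s := Num.sqrt N%:R.
have t0 : 0 < t by rewrite sqrtr_gt0 ltr0n.
have s0 : 0 <= s by exact: sqrtr_ge0.
have tE : t ^+ 2 = s ^+ 2 + 1 by rewrite !sqr_sqrtr ?ler0n // -natr1.
rewrite -(ler_pM2r t0) mulVf ?gt_eqF //.
have st : s <= t by rewrite ler_wsqrtr // ler_nat.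
nra.
Qed.

Lemma sum_invsqrt_le (N : nat) :
  \sum_(1 <= j < N.+1) (Num.sqrt j%:R)^-1 <= 2 * Num.sqrt N%:R :> R.
Proof.
elim: N => [|N IHN]; first by rewrite big_geq // sqrtr0 mulr0.
rewrite big_nat_recr //=; apply: le_trans (lerD IHN (lexx _)) _.
set t := Num.sqrt N.+1%:R; set s := Num.sqrt N%:R.
have t0 : 0 < t by rewrite sqrtr_gt0 ltr0n.
have s0 : 0 <= s by exact: sqrtr_ge0.
have tE : t ^+ 2 = s ^+ 2 + 1 by rewrite !sqr_sqrtr ?ler0n // -natr1.
rewrite -(ler_pM2r t0) mulrDl mulVf ?gt_eqF //.
have := sqr_ge0 (t - s); nra.
Qed.

Lemma sum_invsqrt_trunc (b n : nat) :
  \sum_(1 <= j < n | (j <= b)%N) (Num.sqrt j%:R)^-1 <= 2 * Num.sqrt b%:R :> R.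
Proof.
apply: le_trans (sum_invsqrt_le b).
apply: (@le_trans _ _ (\sum_(1 <= j < maxn n b.+1 | (j <= b)%N) (Num.sqrt j%:R)^-1)).
  have [n0|n0] := posnP n; first by rewrite big_geq ?n0 // sumr_ge0.
  rewrite [leRHS](@big_cat_nat _ _ _ n) ?leq_maxl //= lerDl.
  by apply: sumr_ge0 => j _; rewrite invr_ge0 sqrtr_ge0.
rewrite (@big_cat_nat _ _ _ b.+1) ?leq_maxr //=.
rewrite [X in _ + X]big_nat_cond [X in _ + X]big_pred0 ?addr0; last first.
  by move=> j; lia.
by rewrite big_nat_cond [leRHS]big_nat_cond le_eqVlt; apply/orP; left;
  apply/eqP; apply: eq_bigl => j; lia.
Qed.

(** Summation by parts: against a decreasing nonnegative sequence, an inequality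
    between partial sums is preserved. *)
Lemma abel_le (a w c : nat -> R) (m : nat) :
    (forall j, (j < m)%N -> 0 <= a j) ->
    (forall j, (j.+1 < m)%N -> a j.+1 <= a j) ->
    (forall j, (j <= m)%N -> \sum_(i < j) w i <= \sum_(i < j) c i) ->
  \sum_(i < m) a i * w i <= \sum_(i < m) a i * c i.
Proof.
move=> a0 am wc; rewrite -subr_ge0 -sumrB.
under eq_bigr do rewrite -mulrBr.
case: m a0 am wc => [|m] a0 am wc; first by rewrite big_ord0.
apply: (@le_trans _ _ (a m * \sum_(i < m.+1) (c i - w i))).
  by rewrite mulr_ge0 ?a0 // sumrB subr_ge0 wc.
elim: m a0 am wc => [|m IHm] a0 am wc; first by rewrite !big_ord1.
rewrite big_ord_recr [leRHS]big_ord_recr /= mulrDr lerD2r.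
apply: le_trans (IHm _ _ _).
- rewrite ler_wpM2r ?am //.
  by rewrite sumrB subr_ge0 wc.
- by move=> j jm; rewrite a0 // ltnW.
- by move=> j jm; rewrite am // ltnW.
- by move=> j jm; rewrite wc // ltnW.
Qed.

Section Pairs.
Variable k : nat.
Hypothesis k2 : (1 < k)%N.
Notation G := (free_group k).
Notation q := (degree k).

(** The restricted weak type estimate for one sphere. The usual norm of this
    operator on square summable functions is larger by a factor of order [n]. *)
Lemma pairs_sqrt n (F E : {fset G}) :
  (pairs n F E)%:R <= 8 * Num.sqrt q%:R ^+ n
                        * Num.sqrt #|` F|%:R * Num.sqrt #|` E|%:R :> R.
Proof.
have [->|F0] := eqVneq F fset0.
  by rewrite /pairs big_seq_fset0 cardfs0 sqrtr0 mulr0 mul0r.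
have [->|E0] := eqVneq E fset0.
  rewrite /pairs big1 ?cardfs0 ?sqrtr0 ?mulr0 // => x _.
  by rewrite big_seq_fset0.
rewrite -cardfs_gt0 in F0; rewrite -cardfs_gt0 in E0.
have q3 := degree_ge3 k2.
set r := Num.sqrt q%:R; set sF := Num.sqrt _; set sE := Num.sqrt _.
have r0 : 0 < r by rewrite sqrtr_gt0 ltr0n; lia.
have sF0 : 0 < sF by rewrite sqrtr_gt0 ltr0n.
have sE0 : 0 < sE by rewrite sqrtr_gt0 ltr0n.
have rE : r ^+ 2 = q%:R by rewrite sqr_sqrtr.
have FE : sF ^+ 2 = #|` F|%:R by rewrite sqr_sqrtr.
have EE : sE ^+ 2 = #|` E|%:R by rewrite sqr_sqrtr.
(* The [i]-th term of [pairs_le] is twice the minimum of [g * rho / q ^ i] and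
   [g * q ^ i / rho]. *)
pose rho := sF * r ^+ n / sE; pose g := r ^+ n * sF * sE.
have g0 : 0 < g by rewrite !mulr_gt0 ?exprn_gt0.
have rho0 : 0 < rho by rewrite !mulr_gt0 ?invr_gt0 ?exprn_gt0.
have q2 : 2 <= q%:R :> R by rewrite (ler_nat _ 2 q); lia.
have -> : 8 * r ^+ n * sF * sE = 2 * g * 4 by rewrite /g; ring.
apply: (@le_trans _ _ (2 * g *
    \sum_(i < n.+1) Num.min (rho / q%:R ^+ i) (q%:R ^+ i / rho))); last first.
  rewrite ler_pM2l ?mulr_gt0 ?exprn_gt0 //; apply: le_trans (sum_min_geometric _ q2 rho0) _.
  case: ifPn => [|_]; first by move=> ?; lra.
  by rewrite gerBl invr_ge0 ltW.
apply: (@le_trans _ _ (\sum_(i < n.+1)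
    minn (#|` F| * (2 * q ^ (n - i))) (#|` E| * (2 * q ^ i)))%N%:R).
  by rewrite ler_nat; exact: pairs_le.
rewrite natr_sum mulr_sumr; apply: ler_sum => i _.
have qi0 : 0 < q%:R ^+ i :> R by rewrite exprn_gt0 // ltr0n; lia.
have g2 : 0 <= 2 * g by rewrite pmulr_rge0 // ltW.
rewrite (minr_pMr _ _ g2) le_min; apply/andP; split.
  apply: (@le_trans _ _ (#|` F| * (2 * q ^ (n - i)))%N%:R).
    by rewrite ler_nat geq_minl.
  rewrite !natrM natrX -FE.
  have -> : 2 * g * (rho / q%:R ^+ i) = 2 * sF ^+ 2 * (r ^+ 2) ^+ n / q%:R ^+ i.
    rewrite /g /rho -exprM mulnC exprM; field.
    by rewrite !gt_eqF.
  have -> : (r ^+ 2) ^+ n = q%:R ^+ (n - i) * q%:R ^+ i.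
    by rewrite rE -exprD subnK // -ltnS.
  by rewrite [2 * sF ^+ 2 * _]mulrA mulfK ?gt_eqF // mulrCA mulrA.
apply: (@le_trans _ _ (#|` E| * (2 * q ^ i))%N%:R).
  by rewrite ler_nat geq_minr.
rewrite !natrM natrX -EE.
have -> : 2 * g * (q%:R ^+ i / rho) = 2 * sE ^+ 2 * q%:R ^+ i.
  rewrite /g /rho; field.
  by rewrite !gt_eqF ?exprn_gt0.
lra.
Qed.
End Pairs.
End Inequalities.

(** * Lorentz norms *)

Section Counting.
Set Implicit Arguments.
Unset Strict Implicit.
Context {R : realType} {T : choiceType}.
Implicit Types (A : set T) (Y : {fset T}).
Local Open Scope ereal_scope.

Lemma counting_ge_fset A Y : [set` Y] `<=` A ->
  #|` Y|%:R%:E <= counting A :> \bar R.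
Proof.
move=> YA; rewrite /counting; case: ifPn => [/asboolP fA|]; last by rewrite leey.
rewrite lee_fin ler_nat; apply: fsubset_leq_card; apply/fsubsetP => y yY.
by rewrite in_fset_set // inE; exact: YA.
Qed.

Lemma counting_le_fset A Y : A `<=` [set` Y] ->
  counting A <= #|` Y|%:R%:E :> \bar R.
Proof.
move=> AY; have fA : finite_set A by apply: sub_finite_set AY _; exact: finite_fset.
rewrite /counting asboolT // lee_fin ler_nat; apply: fsubset_leq_card.
by apply/fsubsetP => y; rewrite in_fset_set // inE; exact: AY.
Qed.

Lemma counting_le_sup A (c : R) :
    (forall Y, [set` Y] `<=` A -> (#|` Y|%:R <= c)%R) ->
  counting A <= c%:E.
Proof.
move=> Ac; rewrite /counting; case: ifPn => [/asboolP fA|/asboolPn nfA].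
  by rewrite lee_fin; apply: Ac; rewrite fset_setK.
have c0 : (0 <= c)%R by have := Ac fset0; rewrite cardfs0; apply => y.
have [Y YA cY] := @infinite_set_fset _ A (Num.truncn c).+1 nfA.
have cY' : ((Num.truncn c).+1%:R <= #|` Y|%:R :> R)%R by rewrite ler_nat.
by have := lt_le_trans (truncnS_gt c) (le_trans cY' (Ac Y YA)); rewrite ltxx.
Qed.

End Counting.

Section Rearrangement.
Set Implicit Arguments.
Unset Strict Implicit.
Context {R : realType} {T : choiceType}.
Implicit Types (h : T -> R[i]) (Y : {fset T}).

(** The absolute value of a complex number, as a real number. *)
Definition modulus (z : R[i]) : R := complex.Re (`|z| : R[i]).

Lemma modulusK (z : R[i]) : (modulus z)%:C = `|z|.
Proof. by rewrite RRe_real // normr_real. Qed.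

Lemma modulus_ge0 (z : R[i]) : 0 <= modulus z.
Proof. by rewrite -ler0c modulusK. Qed.

Lemma rearrangement_ge0 h j : (0 <= rearrangement h j)%E.
Proof. by apply: le_ereal_inf_tmp => _ [t [t0 _] <-]; rewrite lee_fin. Qed.

Lemma powR_half (j : nat) : (0 < j)%N ->
  j%:R `^ (2^-1 - 1) = (Num.sqrt j%:R)^-1 :> R.
Proof.
move=> j0; have -> : 2^-1 - 1 = - 2^-1 :> R by lra.
by rewrite powRN powR12_sqrt.
Qed.

Lemma lorentz_normE h :
  (lorentz_norm 2 h = \sum_(1 <= j <oo) ((Num.sqrt j%:R)^-1)%:E * rearrangement h j)%E.
Proof.
rewrite /lorentz_norm; apply: congr_lim; apply/funext => n.
by apply: eq_big_nat => j /andP[j0 _]; rewrite powR_half.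
Qed.

Lemma lorentz_term_ge0 h j :
  (0 <= ((Num.sqrt j%:R)^-1)%:E * rearrangement h j)%E.
Proof.
by rewrite mule_ge0 ?rearrangement_ge0 // lee_fin invr_ge0 sqrtr_ge0.
Qed.

Lemma lorentz_norm_ge h n :
  (\sum_(1 <= j < n) ((Num.sqrt j%:R)^-1)%:E * rearrangement h j
     <= lorentz_norm 2 h)%E.
Proof.
by rewrite lorentz_normE; apply: nneseries_lim_ge => j _ _; exact: lorentz_term_ge0.
Qed.

Lemma lorentz_norm_ge0 h : (0 <= lorentz_norm 2 h)%E.
Proof. by apply: le_trans (lorentz_norm_ge h 0); rewrite big_geq. Qed.

Lemma lorentz_norm_le h (c : R) :
    (forall n, (\sum_(1 <= j < n) ((Num.sqrt j%:R)^-1)%:E * rearrangement h j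
       <= c%:E)%E) ->
  (lorentz_norm 2 h <= c%:E)%E.
Proof.
move=> hc; rewrite lorentz_normE; apply: lime_le.
  by apply: is_cvg_nneseries => j _ _; exact: lorentz_term_ge0.
by near=> n; exact: hc.
Unshelve. all: by end_near. Qed.

(** The elements of [Y] by decreasing values of the modulus of [h]. *)
Definition decreasing_enum h Y : seq T :=
  sort (fun x y => modulus (h y) <= modulus (h x)) Y.

Lemma rearrangement_ge h Y x0 j : (j < #|` Y|)%N ->
  ((modulus (h (nth x0 (decreasing_enum h Y) j)))%:E <= rearrangement h j.+1)%E.
Proof.
move=> jY; set s := decreasing_enum h Y.
have ss : size s = #|` Y| by rewrite size_sort.
have so : sorted (fun x y => modulus (h y) <= modulus (h x)) s.
  by apply: sort_sorted => x y; exact: le_total.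
apply: le_ereal_inf_tmp => _ [t [t0 dt] <-]; rewrite lee_fin leNgt.
apply/negP => tj; move: dt; apply/negP; rewrite -leNgt.
pose Z : {fset T} := [fset x in take j.+1 s]%fset.
have <- : #|` Z| = j.+1.
  rewrite card_fseq undup_id ?size_takel ?ss //.
  by rewrite take_uniq // sort_uniq fset_uniq.
apply: counting_ge_fset => x /=; rewrite /Z in_fset => /(nthP x0)[n nj <-].
rewrite size_takel ?ss // in nj; rewrite nth_take // -modulusK ltcR.
apply: lt_le_trans tj _.
have tr : transitive (fun x y : T => modulus (h y) <= modulus (h x)).
  by move=> y x' z xy yz; exact: le_trans yz xy.
apply: (sorted_leq_nth tr (fun y => lexx _) x0 so) => //.
- by change (n < size s)%N; rewrite ss; lia.
- by change (j < size s)%N; rewrite ss.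
Qed.

(** A weight with sums at most [C * sqrt |E|] over all finite sets [E] pairs with
    [lorentz 2] with norm at most [C]: this is the half of the duality between
    the spaces (2,1) and (2,oo) that is needed. List the values of [h] in
    decreasing order, sum by parts, and use that
    [sqrt j - sqrt (j - 1) <= 1 / sqrt j]. *)
Lemma sum_weight_le_lorentz h Y (w : T -> R) (C : R) : 0 <= C ->
    (forall E : {fset T}, (E `<=` Y)%fset ->
       \sum_(y <- E) w y <= C * Num.sqrt #|` E|%:R) ->
  ((\sum_(y <- Y) modulus (h y) * w y)%:E <= C%:E * lorentz_norm 2 h)%E.
Proof.
move=> C0 wE; have [->|/fset0Pn[x0 _]] := eqVneq Y fset0.
  by rewrite big_seq_fset0 mule_ge0 ?lorentz_norm_ge0.
set s := decreasing_enum h Y.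
have ss : size s = #|` Y| by rewrite size_sort.
have us : uniq s by rewrite sort_uniq fset_uniq.
have so : sorted (fun x y => modulus (h y) <= modulus (h x)) s.
  by apply: sort_sorted => x y; exact: le_total.
have -> : \sum_(y <- Y) modulus (h y) * w y = \sum_(y <- s) modulus (h y) * w y.
  by apply: perm_big; rewrite perm_sym perm_sort.
rewrite (big_nth x0) big_mkord ss.
apply: (@le_trans _ _ (\sum_(i < #|` Y|) modulus (h (nth x0 s i)) *
    (C * (Num.sqrt i.+1%:R - Num.sqrt i%:R)))%:E).
  rewrite lee_fin.
  apply: (@abel_le _ (fun j => modulus (h (nth x0 s j))) (fun j => w (nth x0 s j))
    (fun j => C * (Num.sqrt j.+1%:R - Num.sqrt j%:R))).
  - by move=> j _; exact: modulus_ge0.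
  - move=> j jY; by have /(sortedP x0) := so; apply; rewrite ss.
  - move=> j jY; rewrite -mulr_sumr -(big_mkord xpredT
      (fun i => Num.sqrt i.+1%:R - Num.sqrt i%:R)) telescope_sumr // sqrtr0 subr0.
    pose Z : {fset T} := [fset x in take j s]%fset.
    have Zj : #|` Z| = j.
      by rewrite card_fseq undup_id ?size_takel ?ss // take_uniq.
    have -> : \sum_(i < j) w (nth x0 s i) = \sum_(y <- Z) w y.
      rewrite [RHS](perm_big (take j s)) /=; last first.
        apply: uniq_perm; rewrite ?fset_uniq ?take_uniq //.
        by move=> x; rewrite in_fset.
      rewrite [RHS](big_nth x0) big_mkord size_takel ?ss //.
      by apply: eq_bigr => i _; rewrite nth_take.
    rewrite -Zj; apply: wE; apply/fsubsetP => x.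
    by rewrite in_fset => /mem_take; rewrite mem_sort.
apply: le_trans (lee_wpmul2l _ (lorentz_norm_ge h #|` Y|.+1)); last by rewrite lee_fin.
rewrite big_add1 big_mkord ge0_sume_distrr; last first.
  by move=> i _; exact: lorentz_term_ge0.
rewrite -sumEFin; apply: lee_sum => i _.
apply: (@le_trans _ _ ((C * (Num.sqrt i.+1%:R)^-1)%:E *
    (modulus (h (nth x0 s i)))%:E)%E).
  rewrite -EFinM lee_fin mulrC ler_wpM2r ?modulus_ge0 // ler_wpM2l //.
  exact: sqrt_succ_sub.
rewrite EFinM -muleA; apply: lee_wpmul2l; first by rewrite lee_fin.
apply: lee_wpmul2l; first by rewrite lee_fin invr_ge0 sqrtr_ge0.
exact: rearrangement_ge.
Qed.

Definition fset_indicator Y (x : T) : R[i] := if x \in Y then 1 else 0.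

Lemma lorentz_norm_indicator Y :
  (lorentz_norm 2 (fset_indicator Y) <= (2 * Num.sqrt #|` Y|%:R)%:E)%E.
Proof.
set b := #|` Y|.
have tail j : (b < j)%N -> (rearrangement (fset_indicator Y) j <= 0)%E.
  move=> bj; apply: ereal_inf_lbound; exists 0 => //; split=> //.
  apply: (@le_lt_trans _ _ (b%:R%:E)); last by rewrite lte_fin ltr_nat.
  apply: counting_le_fset => x /=; rewrite /fset_indicator.
  by case: ifPn => // _; rewrite normr0 ltxx.
have le1 j : (0 < j)%N -> (rearrangement (fset_indicator Y) j <= 1)%E.
  move=> j0; apply: ereal_inf_lbound; exists 1 => //; split=> //.
  rewrite /distribution_function [X in counting X](_ : _ = set0).
    by rewrite /counting asboolT // fset_set0 lte_fin ltr_nat.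
  rewrite -subset0 => x /=; rewrite /fset_indicator.
  by case: ifPn => _; rewrite ?normr1 ?normr0 ltcR ?ltxx // ltr10.
apply: lorentz_norm_le => n.
apply: (@le_trans _ _ (\sum_(1 <= j < n | (j <= b)%N) (Num.sqrt j%:R)^-1)%:E).
  rewrite -sumEFin [leRHS]big_mkcond [leLHS]big_nat [leRHS]big_nat.
  apply: lee_sum => j /andP[j0 _].
  have c0 : (0 <= ((Num.sqrt j%:R)^-1)%:E :> \bar R)%E.
    by rewrite lee_fin invr_ge0 sqrtr_ge0.
  case: leqP => [_|/tail jb].
    by rewrite -[leRHS]mule1; apply: lee_wpmul2l; rewrite ?le1.
  by rewrite -(mule0 ((Num.sqrt j%:R)^-1)%:E); exact: lee_wpmul2l.
by rewrite lee_fin sum_invsqrt_trunc.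
Qed.

(** The finite sets [F] on which [h] exceeds [t] determine the weak norm. *)
Lemma weak_norm_le h (c : R) : 0 <= c ->
    (forall t (F : {fset T}), 0 < t -> {in F, forall x, t < modulus (h x)} ->
       t * Num.sqrt #|` F|%:R <= c) ->
  (weak_norm 2 h <= c%:E)%E.
Proof.
move=> c0 hF; rewrite /weak_norm.
have -> : c%:E = ((c ^+ 2)%:E `^ 2^-1)%E.
  by rewrite poweR_EFin powR12_sqrt ?sqr_ge0 // sqrtr_sqr ger0_norm.
set s := ereal_sup _.
have sc : (s <= (c ^+ 2)%:E)%E.
  apply: ge_ereal_sup => _ [t t0 <-].
  rewrite /= in t0; rewrite powR_mulrn ?(ltW t0) //.
  have t20 : (0 < t ^+ 2)%R by rewrite exprn_gt0.
  apply: (@le_trans _ _ ((t ^+ 2)%:E * (c ^+ 2 / t ^+ 2)%:E)%E); last first.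
    by rewrite -EFinM lee_fin mulrC mulfVK // gt_eqF.
  apply: lee_wpmul2l; first by rewrite lee_fin ltW.
  apply: counting_le_sup => Y Yt.
  rewrite ler_pdivlMr // mulrC.
  rewrite -[X in _ * X](sqr_sqrtr (ler0n R _)) -exprMn.
  rewrite ler_pXn2r ?nnegrE ?mulr_ge0 ?sqrtr_ge0 ?(ltW t0) //.
  by apply: hF => // x /Yt /=; rewrite -modulusK ltcR.
have s0 : (0 <= s)%E.
  apply: ereal_sup_ge; exists ((1 `^ 2)%:E * distribution_function h 1)%E.
    by exists 1 => //; exact: ltr01.
  rewrite mule_ge0 ?lee_fin ?powR_ge0 // -[leLHS]/((0%N%:R)%:E).
  by rewrite -(cardfs0 T); apply: counting_ge_fset => x.
apply: gt0_ler_poweR; rewrite ?invr_ge0 // in_itv /= ?leey ?andbT //.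
by rewrite lee_fin sqr_ge0.
Qed.

Lemma weak_norm_ge h (c t : R) (F : {fset T}) : 0 < t ->
    (weak_norm 2 h <= c%:E)%E -> {in F, forall x, t < modulus (h x)} ->
  t * Num.sqrt #|` F|%:R <= c.
Proof.
move=> t0 hc Ft; rewrite -lee_fin; apply: le_trans hc.
have -> : (t * Num.sqrt #|` F|%:R)%:E = ((t ^+ 2 * #|` F|%:R)%:E `^ 2^-1)%E.
  rewrite poweR_EFin powR12_sqrt; last exact: mulr_ge0 (sqr_ge0 _) (ler0n _ _).
  rewrite sqrtrM ?sqr_ge0 //.
  by rewrite sqrtr_sqr gtr0_norm.
have tF : ((t ^+ 2 * #|` F|%:R)%:E <= ereal_sup [set (t `^ 2)%:E *
    distribution_function h t | t in [set t : R | (0 < t)%R]])%E.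
  apply: ereal_sup_ge; exists ((t `^ 2)%:E * distribution_function h t)%E.
    by exists t.
  rewrite powR_mulrn ?(ltW t0) // EFinM; apply: lee_wpmul2l; first by rewrite lee_fin sqr_ge0.
  by apply: counting_ge_fset => x /= /Ft; rewrite -modulusK ltcR.
have tF0 : (0 <= (t ^+ 2 * #|` F|%:R)%:E)%E.
  by rewrite lee_fin mulr_ge0 // sqr_ge0.
rewrite /weak_norm; apply: gt0_ler_poweR => //; rewrite ?invr_ge0 // in_itv /= ?leey ?andbT //.
exact: le_trans tF.
Qed.

End Rearrangement.

(** * Unconditional sums of complex families *)

Section Summability.
Set Implicit Arguments.
Unset Strict Implicit.
Context {R : realType} {T : choiceType}.

Lemma modulusM (z w : R[i]) : modulus (z * w) = modulus z * modulus w.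
Proof. by apply: complexI; rewrite rmorphM /= !modulusK normrM. Qed.

Lemma modulusD (z w : R[i]) : modulus (z + w) <= modulus z + modulus w.
Proof. by rewrite -lecR rmorphD /= !modulusK ler_normD. Qed.

Lemma modulus_real (a : R) : 0 <= a -> modulus a%:C = a.
Proof. by move=> a0; apply: complexI; rewrite modulusK ger0_norm // ler0c. Qed.

Lemma modulus_sum (s : seq T) (u : T -> R[i]) :
  modulus (\sum_(i <- s) u i) <= \sum_(i <- s) modulus (u i).
Proof.
elim: s => [|i s IHs]; first by rewrite !big_nil modulus_real.
by rewrite !big_cons (le_trans (modulusD _ _)) // lerD2l.
Qed.

Lemma modulus_le_ReIm (z : R[i]) :
  modulus z <= `|complex.Re z| + `|complex.Im z|.
Proof.
rewrite /modulus normc_def /= -[leRHS]ger0_norm ?addr_ge0 // -sqrtr_sqr.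
rewrite ler_wsqrtr // sqrrD !real_normK ?num_real // -addrA lerD2l.
by rewrite lerDr mulrn_wge0 // mulr_ge0.
Qed.

Lemma Re_le_modulus (z : R[i]) : `|complex.Re z| <= modulus z.
Proof. by rewrite -lecR modulusK normc_ge_Re. Qed.

Lemma Im_le_modulus (z : R[i]) : `|complex.Im z| <= modulus z.
Proof.
by rewrite /modulus normc_def /= -sqrtr_sqr ler_wsqrtr // lerDr sqr_ge0.
Qed.

Lemma sum_fset_le (A J : {fset T}) (u : T -> R) : (forall i, 0 <= u i) ->
  (A `<=` J)%fset -> \sum_(i <- A) u i <= \sum_(i <- J) u i.
Proof.
move=> u0 AJ; rewrite (big_fsetID _ (mem A) J) /=.
have -> : [fset x | x in J & x \in A]%fset = A.
  by apply/fsetP => x; rewrite !inE /= andb_idl // => /(fsubsetP AJ).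
by rewrite lerDl sumr_ge0.
Qed.

Lemma ge0_sum_cvg (u : T -> R) (B : R) : (forall i, 0 <= u i) ->
    (forall J : {fset T}, \sum_(i <- J) u i <= B) ->
  exists l, forall e, 0 < e -> exists A : {fset T},
    forall J : {fset T}, (A `<=` J)%fset -> `|l - \sum_(i <- J) u i| <= e.
Proof.
move=> u0 uB; pose S := [set \sum_(i <- J) u i | J in [set: {fset T}]].
have hS : has_sup S.
  split; first by exists (\sum_(i <- fset0) u i); exists fset0.
  by exists B => _ [J _ <-].
exists (sup S) => e e0; have [_ [A _ <-] Ae] := sup_adherent e0 hS.
exists A => J AJ; have JS : \sum_(i <- J) u i <= sup S.
  by apply: sup_upper_bound => //; exists J.
rewrite ger0_norm ?subr_ge0 //.
have := sum_fset_le u0 AJ; lra.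
Qed.

(** [u] is the difference of the nonnegative families [`|u| + u] and [`|u|]. *)
Lemma real_sum_cvg (u : T -> R) (B : R) :
    (forall J : {fset T}, \sum_(i <- J) `|u i| <= B) ->
  exists l, forall e, 0 < e -> exists A : {fset T},
    forall J : {fset T}, (A `<=` J)%fset -> `|l - \sum_(i <- J) u i| <= e.
Proof.
move=> uB.
have p0 i : 0 <= `|u i| + u i by have := ler_norm (- u i); rewrite normrN; lra.
have pB (J : {fset T}) : \sum_(i <- J) (`|u i| + u i) <= B + B.
  rewrite big_split /= lerD // (le_trans _ (uB J)) //.
  by apply: ler_sum => i _; exact: ler_norm.
have [l1 hl1] := ge0_sum_cvg p0 pB.
have [l2 hl2] := ge0_sum_cvg (fun i => normr_ge0 (u i)) uB.
exists (l1 - l2) => e e0; have e20 : 0 < e / 2 by lra.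
have [A1 hA1] := hl1 _ e20; have [A2 hA2] := hl2 _ e20.
exists (A1 `|` A2)%fset => J; rewrite fsubUset => /andP[/hA1 + /hA2].
rewrite big_split /=; set a := \sum_(i <- J) `|u i|; set b := \sum_(i <- J) u i.
rewrite !ler_norml; lra.
Qed.

Lemma partial_sumE (u : T -> R[i]^o) J :
  summability.partial_sum u J = \sum_(i <- J) u i.
Proof. by rewrite /summability.partial_sum big_seq_fsetE. Qed.

Lemma abs_summable_cvg (u : T -> R[i]^o) (B : R) :
    (forall J : {fset T}, \sum_(i <- J) modulus (u i) <= B) ->
  cvg (summability.partial_sum u @ summability.totally).
Proof.
move=> uB.
have [a ha] : exists l, forall e, 0 < e -> exists A : {fset T},
    forall J : {fset T}, (A `<=` J)%fset ->
    `|l - \sum_(i <- J) complex.Re (u i)| <= e.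
  apply: (@real_sum_cvg _ B) => J; apply: le_trans (uB J).
  by apply: ler_sum => i _; exact: Re_le_modulus.
have [b hb] : exists l, forall e, 0 < e -> exists A : {fset T},
    forall J : {fset T}, (A `<=` J)%fset ->
    `|l - \sum_(i <- J) complex.Im (u i)| <= e.
  apply: (@real_sum_cvg _ B) => J; apply: le_trans (uB J).
  by apply: ler_sum => i _; exact: Im_le_modulus.
have FT := @summability.totally_filter T.
apply/cvg_ex; exists (a +i* b : R[i]^o); apply/cvgrPdist_le => /= eps eps0.
have epsE : eps = (complex.Re eps)%:C by rewrite RRe_real // gtr0_real.
have e0 : 0 < complex.Re eps by rewrite -ltcR -epsE.
have e20 : 0 < complex.Re eps / 2 by lra.
have [A hA] := ha _ e20; have [A' hA'] := hb _ e20.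
exists (A `|` A')%fset => // J /=; rewrite fsubUset => /andP[/hA HA /hA' HA'].
rewrite epsE -modulusK lecR partial_sumE.
apply: le_trans (modulus_le_ReIm _) _.
have ReS : complex.Re (\sum_(i <- J) u i : R[i]) = \sum_(i <- J) complex.Re (u i).
  by apply: big_morph => // -[x y] [z w].
have ImS : complex.Im (\sum_(i <- J) u i : R[i]) = \sum_(i <- J) complex.Im (u i).
  by apply: big_morph => // -[x y] [z w].
have ReB (z w : R[i]) : complex.Re (z - w) = complex.Re z - complex.Re w.
  by case: z w => [x y] [z w].
have ImB (z w : R[i]) : complex.Im (z - w) = complex.Im z - complex.Im w.
  by case: z w => [x y] [z w].
by rewrite ReB ImB ReS ImS /=; lra.
Qed.

Lemma eventually_modulus_sum_gt (u : T -> R[i]^o) (t : R) :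
    cvg (summability.partial_sum u @ summability.totally) ->
    t < modulus (summability.sum u) ->
  exists A : {fset T}, forall J : {fset T}, (A `<=` J)%fset ->
    t < modulus (\sum_(i <- J) u i).
Proof.
have FT := @summability.totally_filter T.
move=> cu tu; have e0 : 0 < (modulus (summability.sum u) - t)%:C.
  by rewrite -[0]/(0%:C) ltcR subr_gt0.
have /cvgrPdist_lt/(_ _ e0) : summability.partial_sum u @ summability.totally
    --> (summability.sum u : R[i]^o) by exact: cu.
case=> A _ hA; exists A => J /hA /=.
rewrite partial_sumE -modulusK ltcR => H.
have := modulusD (summability.sum u - \sum_(i <- J) u i) (\sum_(i <- J) u i).
rewrite subrK; lra.
Qed.

Lemma sum_finite_support (u : T -> R[i]^o) (A : {fset T}) :
  (forall i, i \notin A -> u i = 0) -> summability.sum u = \sum_(i <- A) u i.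
Proof.
have FT := @summability.totally_filter T.
move=> uA; apply/cvg_lim; first exact: norm_hausdorff.
apply: cvg_near_cst; exists A => // J /= AJ; rewrite partial_sumE.
rewrite (big_fsetID _ (mem A) J) /= [X in _ + X]big1_fset ?addr0.
  have -> // : [fset x | x in J & x \in A]%fset = A.
  by apply/fsetP => x; rewrite !inE /= andb_idl // => /(fsubsetP AJ).
by move=> i; rewrite !inE => /andP[_ /uA].
Qed.
End Summability.

(** * Radial functions *)

Section Radial.
Set Implicit Arguments.
Unset Strict Implicit.
Context {R : realType}.
Variable k : nat.
Hypothesis k2 : (1 < k)%N.
Notation G := (free_group k).
Notation q := (degree k).
Let r : R := Num.sqrt q%:R.

Let r_gt0 : 0 < r.
Proof. by rewrite sqrtr_gt0 ltr0n; have := degree_ge3 k2; lia. Qed.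

Let r_sqr : r ^+ 2 = q%:R. Proof. by rewrite sqr_sqrtr. Qed.

Let r_ge : 3 / 2 <= r.
Proof.
have : 3 <= r ^+ 2 by rewrite r_sqr (ler_nat _ 3); exact: degree_ge3.
have := r_gt0; nra.
Qed.

Lemma sum_by_level (T : Type) (s : seq T) (l : T -> nat) (g : nat -> R) N :
    all (fun x => l x < N)%N s ->
  \sum_(x <- s) g (l x) = \sum_(n < N) g n * (count (fun x => l x == n) s)%:R.
Proof.
elim: s => [|x s IHs] /=; first by rewrite big_nil big1 // => n _; rewrite mulr0.
move=> /andP[xN /IHs]; rewrite big_cons => ->.
under [RHS]eq_bigr do rewrite natrD mulrDr.
rewrite big_split /=; congr (_ + _).
rewrite (bigD1 (Ordinal xN)) //= eqxx mulr1 big1 ?addr0 // => n nx.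
by rewrite (_ : (l x == n) = false) ?mulr0 //; apply: contraNF nx => /eqP xn; apply/eqP/val_inj.
Qed.

Lemma sum_pow_le N : \sum_(n < N.+1) r ^+ n <= 3 * r ^+ N.
Proof.
elim: N => [|N IHN]; first by rewrite big_ord1 expr0; lra.
rewrite big_ord_recr /=; apply: le_trans (lerD IHN (lexx _)) _.
have := exprn_gt0 N r_gt0; rewrite exprS; have := r_ge; nra.
Qed.

Lemma count_sphere (E : {fset G}) n :
  (count (fun x => fg_length x == n) E <= 2 * q ^ n)%N.
Proof.
apply: leq_trans (size_words_le k2 n); rewrite -card_fsphere -size_filter.
apply: uniq_leq_size; first exact: filter_uniq (fset_uniq E).
by move=> x; rewrite mem_filter => /andP[xn _]; rewrite in_fsphere.
Qed.

(** The weight [r ^- |x|] belongs to the weak space (2,oo). *)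
Lemma weight_sqrt (E : {fset G}) :
  \sum_(x <- E) (r ^+ fg_length x)^-1 <= (6 + r) * Num.sqrt #|` E|%:R.
Proof.
have [->|E0] := eqVneq E fset0.
  by rewrite big_seq_fset0 cardfs0 sqrtr0 mulr0.
rewrite -cardfs_gt0 in E0.
have q1 : (1 < q)%N by have := degree_ge3 k2; lia.
have /andP[] := trunc_log_bounds q1 E0; set N := trunc_log _ _ => NE EN.
set sE := Num.sqrt _.
have rNE : r ^+ N <= sE.
  rewrite -(ler_pXn2r (n := 2)) ?nnegrE ?sqrtr_ge0 ?exprn_ge0 ?(ltW r_gt0) //.
  by rewrite exprAC r_sqr sqr_sqrtr // -natrX ler_nat.
have ENr : sE <= r ^+ N.+1.
  rewrite -(ler_pXn2r (n := 2)) ?nnegrE ?sqrtr_ge0 ?exprn_ge0 ?(ltW r_gt0) //.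
  by rewrite exprAC r_sqr sqr_sqrtr // -natrX ler_nat ltnW.
(* [N] is the largest radius with [q ^ N <= |E|]: the points of [E] in the ball
   of radius [N] are at most as many as the ball has on each sphere, and every
   other point weighs at most [r ^- N]. *)
rewrite (bigID (fun x : G => fg_length x <= N)%N) /= mulrDl; apply: lerD.
  rewrite -big_filter (@sum_by_level _ _ (@fg_length k) (fun n => (r ^+ n)^-1) N.+1).
    apply: (@le_trans _ _ (\sum_(n < N.+1) 2 * r ^+ n)).
      apply: ler_sum => n _; have rn0 := exprn_gt0 n r_gt0.
      rewrite mulrC ler_pdivrMr // -mulrA -expr2 exprAC r_sqr -natrX -natrM ler_nat.
      rewrite count_filter; apply: leq_trans (count_sphere E n).
      by apply: sub_count => x /= /andP[].
    rewrite -mulr_sumr; have := sum_pow_le N; lra.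
  by apply/allP => x; rewrite mem_filter => /andP[].
apply: (@le_trans _ _ (\sum_(x <- E) (r ^+ N)^-1)).
  rewrite big_mkcond; apply: ler_sum => x _; case: ifPn => [|_].
    rewrite -ltnNge => Nx; rewrite lef_pV2 ?posrE ?exprn_gt0 //.
    by rewrite ler_weXn2l ?(ltnW Nx) //; have := r_ge; lra.
  by rewrite invr_ge0 exprn_ge0 // ltW.
rewrite big_const_seq count_predT iter_addr_0 -[_ *+ _]mulr_natr.
rewrite mulrC ler_pdivrMr ?exprn_gt0 //.
have -> : #|` E|%:R = sE * sE :> R by rewrite -expr2 sqr_sqrtr.
rewrite -mulrA mulrCA ler_pM2l -?exprS //.
by rewrite sqrtr_gt0 ltr0n.
Qed.

Variable f_ : nat -> R.
Hypothesis f_ge0 : forall n, 0 <= f_ n.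
Variable f : G -> R[i].
Hypothesis fE : forall x, f x = (f_ (fg_length x))%:C.

(** Pair [f] with the weight [r ^- |x|]: on the sphere of radius [n] the pairing
    is [f_ n * r ^- n * |S_n|], and [|S_n| >= r ^ (2 n)]. *)
Lemma lorentz_series : lorentz 2 f ->
  exists K, forall N, \sum_(n < N) f_ n * r ^+ n <= K.
Proof.
rewrite /lorentz /= => fL; have f0 := lorentz_norm_ge0 f.
have ffin : lorentz_norm 2 f \is a fin_num by rewrite ge0_fin_numE.
exists ((6 + r) * fine (lorentz_norm 2 f)) => -[|N].
  by rewrite big_ord0 mulr_ge0 ?fine_ge0 // addr_ge0 // ltW.
rewrite -lee_fin EFinM fineK //.
have r6 : 0 <= 6 + r by rewrite addr_ge0 // ltW.
apply: le_trans (@sum_weight_le_lorentz _ _ f (fball k N) (fun x => (r ^+ fg_length x)^-1) _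
  r6 (fun E _ => weight_sqrt E)).
rewrite lee_fin.
have -> : \sum_(x <- fball k N) modulus (f x) / r ^+ fg_length x =
    \sum_(x <- fball k N) (f_ (fg_length x) / r ^+ fg_length x).
  by apply: eq_bigr => x _; rewrite fE modulus_real.
rewrite (@sum_by_level _ _ (@fg_length k) (fun n => f_ n / r ^+ n) N.+1); last first.
  by apply/allP => x; rewrite in_fball.
apply: ler_sum => n _; have rn0 := exprn_gt0 n r_gt0.
rewrite -mulrA ler_wpM2l // mulrC ler_pdivlMr // -expr2 exprAC r_sqr -natrX ler_nat.
apply: leq_trans (size_words_ge k2 n) _; rewrite -card_fsphere -size_filter.
apply: uniq_leq_size; first exact: fset_uniq.
move=> x xS; have : x \in fsphere k n by [].
rewrite in_fsphere => xn; rewrite mem_filter xn /=.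
have xN : (fg_length x <= N)%N by move/eqP: xn => ->; rewrite -ltnS.
by move: xN; rewrite -in_fball.
Qed.

Lemma longest (Y : {fset G}) : Y != fset0 ->
  exists2 y, y \in Y & forall z, z \in Y -> (fg_length z <= fg_length y)%N.
Proof.
move=> /fset0Pn[y0 yY].
have := @arg_maxnP _ [` yY]%fset xpredT (fun z => fg_length (val z)) isT.
case=> y _ ymax; exists (val y); first exact: valP.
by move=> z zY; have := ymax [` zY]%fset isT.
Qed.

(** With [t] the sum on the right, [f] can exceed [t] only on points [x] such that
    the ball of radius [|x|] has fewer than [j] elements. These points lie in one
    such ball. *)
Lemma rearrangement_radial j : (0 < j)%N ->
  (rearrangement f j <=
   \sum_(0 <= m <oo) (if (j <= #|` fball k m|)%N then f_ m else 0)%:E)%E.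
Proof.
move=> j0; set S := (\sum_(0 <= m <oo) _)%E.
have term_ge0 m : (0 <= (if (j <= #|` fball k m|)%N then f_ m else 0)%:E)%E.
  by case: ifPn; rewrite lee_fin.
have S0 : (0 <= S)%E by exact: nneseries_ge0.
have [->|Sfin] := eqVneq S +oo%E; first by rewrite leey.
have {Sfin} Sfin : S \is a fin_num by rewrite ge0_fin_numE // lt_neqAle Sfin leey.
apply: ereal_inf_lbound; exists (fine S); last by rewrite fineK.
split; first exact: fine_ge0.
apply: (@le_lt_trans _ _ (j.-1%:R)%:E); last by rewrite lte_fin ltr_nat prednK.
apply: counting_le_sup => Y YS; rewrite ler_nat.
have [->|/longest[y yY ymax]] := eqVneq Y fset0; first by rewrite cardfs0.
rewrite -ltnS prednK //.
have YB : (#|` Y| <= #|` fball k (fg_length y)|)%N.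
  by apply: fsubset_leq_card; apply/fsubsetP => z /ymax; rewrite in_fball.
apply: leq_ltn_trans YB _; rewrite ltnNge; apply/negP => jy.
have /= := YS y yY; rewrite fE -modulusK modulus_real // ltcR ltNge.
move/negP; apply; rewrite -lee_fin fineK //.
apply: le_trans (nneseries_lim_ge (fg_length y).+1 _) => //.
rewrite big_nat_recr //= jy leeDr // sume_ge0 //.
Qed.

(** Insert [rearrangement_radial] in the Lorentz norm and exchange the sums: the
    coefficient of [f_ m] is the sum of [1 / sqrt j] for [j <= |B_m|], of the
    order of [sqrt |B_m|], hence of [r ^ m]. *)
Lemma series_lorentz K : (forall N, \sum_(n < N) f_ n * r ^+ n <= K) ->
  lorentz 2 f.
Proof.
move=> fK; rewrite /lorentz /=; apply: (@le_lt_trans _ _ (4 * K)%:E); last exact: ltry.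
apply: lorentz_norm_le => n.
pose a m j : R := if (j <= #|` fball k m|)%N then f_ m else 0.
have a0 m j : 0 <= a m j by rewrite /a; case: ifPn.
have s0 j : 0 <= (Num.sqrt j%:R)^-1 :> R by rewrite invr_ge0 sqrtr_ge0.
apply: (@le_trans _ _ (\sum_(1 <= j < n)
    \sum_(0 <= m <oo) ((Num.sqrt j%:R)^-1 * a m j)%:E)%E).
  rewrite big_nat [leRHS]big_nat; apply: lee_sum => j /andP[j0 _].
  have -> : (\sum_(0 <= m <oo) ((Num.sqrt j%:R)^-1 * a m j)%:E =
      ((Num.sqrt j%:R)^-1)%:E * \sum_(0 <= m <oo) (a m j)%:E)%E.
    by rewrite -nneseriesZl // => m _; rewrite lee_fin.
  apply: lee_wpmul2l; first by rewrite lee_fin.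
  exact: rearrangement_radial.
rewrite -nneseries_sum_nat; last by move=> i j; rewrite lee_fin mulr_ge0.
apply: lime_le.
  apply: is_cvg_nneseries => m _ _; apply: sume_ge0 => j _.
  by rewrite lee_fin mulr_ge0.
near=> N; rewrite big_mkord.
apply: (@le_trans _ _ (\sum_(m < N) (4 * (f_ m * r ^+ m))%:E)%E); last first.
  by rewrite sumEFin lee_fin -mulr_sumr ler_pM2l.
apply: lee_sum => m _; rewrite sumEFin lee_fin.
have -> : \sum_(1 <= j < n) (Num.sqrt j%:R)^-1 * a m j =
    f_ m * \sum_(1 <= j < n | (j <= #|` fball k m|)%N) (Num.sqrt j%:R)^-1.
  rewrite mulr_sumr [RHS]big_mkcond; apply: eq_bigr => j _.
  by rewrite /a; case: ifPn => _; rewrite ?mulr0 // mulrC.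
rewrite mulrCA ler_wpM2l //; apply: le_trans (sum_invsqrt_trunc _ _ _) _.
suff : Num.sqrt #|` fball k m|%:R <= 2 * r ^+ m by lra.
have rm0 := exprn_gt0 m r_gt0.
rewrite -(ler_pXn2r (n := 2)) ?nnegrE ?sqrtr_ge0 ?mulr_ge0 ?(ltW rm0) //.
rewrite sqr_sqrtr // exprMn exprAC r_sqr.
apply: (@le_trans _ _ (3 * q%:R ^+ m)).
  by rewrite -natrX -natrM ler_nat card_fball.
by rewrite ler_pM2r ?exprn_gt0 -?r_sqr ?exprn_gt0 //; lra.
Unshelve. all: by end_near. Qed.

(** * Convolution by a radial function *)

(** The restricted estimate, for indicators: sum [pairs_sqrt] over the radii. *)
Lemma radial_kernel_sum_le K (F E : {fset G}) :
    (forall N, \sum_(n < N) f_ n * r ^+ n <= K) ->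
  \sum_(y <- E) \sum_(x <- F) f_ (fg_length (x * y^-1)%g)
    <= 8 * K * Num.sqrt #|` F|%:R * Num.sqrt #|` E|%:R.
Proof.
move=> fK.
pose l (x y : G) := fg_length (x * y^-1)%g.
pose N := (\sum_(x <- F) \sum_(y <- E) l x y).+1.
have lN x y : x \in F -> y \in E -> (l x y < N)%N.
  move=> xF yE; rewrite ltnS (big_fsetD1 x) //= (big_fsetD1 y) //=.
  by rewrite -addnA leq_addr.
rewrite exchange_big /=.
apply: (@le_trans _ _ (\sum_(n < N) f_ n * (pairs n F E)%:R)).
  rewrite /pairs; under [leRHS]eq_bigr do rewrite natr_sum mulr_sumr.
  rewrite [leRHS]exchange_big /= big_seq_cond [leRHS]big_seq_cond.
  apply: ler_sum => x /andP[xF _].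
  rewrite (@sum_by_level _ _ (l x) f_ N).
    by apply: ler_sum => n _; rewrite sum_bool.
  by apply/allP => y yE; exact: lN.
apply: (@le_trans _ _ (\sum_(n < N) 8 * Num.sqrt #|` F|%:R * Num.sqrt #|` E|%:R
    * (f_ n * r ^+ n))).
  apply: ler_sum => n _.
  apply: le_trans (ler_wpM2l (f_ge0 n) (pairs_sqrt R k2 n F E)) _.
  by rewrite le_eqVlt; apply/orP; left; apply/eqP; rewrite /r; ring.
rewrite -mulr_sumr.
have -> : 8 * K * Num.sqrt #|` F|%:R * Num.sqrt #|` E|%:R =
   8 * Num.sqrt #|` F|%:R * Num.sqrt #|` E|%:R * K by ring.
by rewrite ler_wpM2l // !mulr_ge0 ?sqrtr_ge0.
Qed.

Lemma convolution_termE (h : G -> R[i]) x y :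
  modulus (convolution_term f h x y) =
  modulus (h y) * f_ (fg_length (x * y^-1)%g).
Proof. by rewrite /convolution_term modulusM fE modulus_real // mulrC. Qed.

Lemma convolution_term_sum_le K (h : G -> R[i]) (F E : {fset G}) :
    (forall N, \sum_(n < N) f_ n * r ^+ n <= K) ->
  ((\sum_(x <- F) \sum_(y <- E) modulus (convolution_term f h x y))%:E
    <= (8 * K * Num.sqrt #|` F|%:R)%:E * lorentz_norm 2 h)%E.
Proof.
move=> fK; have K0 : 0 <= K by have := fK 0%N; rewrite big_ord0.
rewrite exchange_big /=.
have -> : \sum_(y <- E) \sum_(x <- F) modulus (convolution_term f h x y) =
    \sum_(y <- E) modulus (h y) * \sum_(x <- F) f_ (fg_length (x * y^-1)%g).
  apply: eq_bigr => y _; rewrite mulr_sumr; apply: eq_bigr => x _.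
  exact: convolution_termE.
apply: sum_weight_le_lorentz; first by rewrite !mulr_ge0 ?sqrtr_ge0.
by move=> E' _; exact: radial_kernel_sum_le.
Qed.

(** For finite [F] inside the set where [f * h] exceeds [t], one finite set [E]
    of indices makes all the partial sums at the points of [F] exceed [t]; sum
    them over [F] and apply the estimate for finite sets. *)
Lemma series_restricted K : (forall N, \sum_(n < N) f_ n * r ^+ n <= K) ->
  restricted_weak_type 2 (convolution_domain f) (convolution f).
Proof.
move=> fK; have K0 : 0 <= K by have := fK 0%N; rewrite big_ord0.
have dom h : lorentz 2 h -> convolution_domain f h.
  rewrite /lorentz /= => hL x; have h0 := lorentz_norm_ge0 h.
  have hfin : lorentz_norm 2 h \is a fin_num by rewrite ge0_fin_numE.
  apply: (@abs_summable_cvg _ _ _ (8 * K * fine (lorentz_norm 2 h))) => J.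
  rewrite -lee_fin EFinM fineK //; have := convolution_term_sum_le h [fset x]%fset J fK.
  by rewrite big_seq_fset1 cardfs1 sqrtr1 mulr1.
split; first exact: dom.
exists (8 * K) => h hL; have := dom h hL; have h0 := lorentz_norm_ge0 h.
have hfin : lorentz_norm 2 h \is a fin_num by rewrite ge0_fin_numE.
move=> hdom; rewrite -(fineK hfin) -EFinM; apply: weak_norm_le.
  by rewrite mulr_ge0 ?fine_ge0 // mulr_ge0.
move=> t F t0 tF.
have [E hE] : exists E : {fset G}, forall x, x \in F ->
    t < modulus (\sum_(y <- E) convolution_term f h x y).
  have /choice[A hA] (x : G) : exists A : {fset G}, x \in F ->
      forall J : {fset G}, (A `<=` J)%fset ->
      t < modulus (\sum_(y <- J) convolution_term f h x y).
    have [xF|xF] := boolP (x \in F); last by exists fset0.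
    have [A hA] := eventually_modulus_sum_gt (hdom x) (tF x xF).
    by exists A.
  exists (\bigcup_(x <- F) A x)%fset => x xF; apply: hA => //.
  exact: bigfcup_sup.
have [->|F0] := eqVneq F fset0.
  by rewrite cardfs0 sqrtr0 mulr0 mulr_ge0 ?fine_ge0 // mulr_ge0.
rewrite -cardfs_gt0 in F0.
have sF0 : 0 < Num.sqrt #|` F|%:R :> R by rewrite sqrtr_gt0 ltr0n.
have H : t * #|` F|%:R <= 8 * K * Num.sqrt #|` F|%:R * fine (lorentz_norm 2 h).
  rewrite -lee_fin EFinM [leRHS]EFinM fineK //.
  apply: le_trans (convolution_term_sum_le h F E fK); rewrite -EFinM lee_fin.
  rewrite mulr_natr -iter_addr_0 -(count_predT F) -big_const_seq.
  rewrite big_seq_cond [leRHS]big_seq_cond; apply: ler_sum => x /andP[xF _].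
  by apply: le_trans (ltW (hE x xF)) _; exact: modulus_sum.
rewrite -(ler_pM2r sF0) -[leLHS]mulrA -expr2 sqr_sqrtr //.
by apply: le_trans H _; rewrite mulrAC.
Qed.

(** Test the operator on the indicator [h] of the ball of radius [N]: at every
    point of the sphere of radius [N], [f * h] is at least [q ^- 2] times the
    partial sum [P] of the series, and that sphere makes up at least a third of
    the ball. *)
Lemma restricted_series :
    restricted_weak_type 2 (convolution_domain f) (convolution f) ->
  exists K, forall N, \sum_(n < N) f_ n * r ^+ n <= K.
Proof.
move=> [_ [M hM]]; exists (8 * q%:R ^+ 2 * `|M|) => N.
have q3 := degree_ge3 k2.
pose B := fball k N; pose S := fsphere k N; pose h := @fset_indicator R _ B.
have BS : (#|` B| <= 3 * #|` S|)%N.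
  apply: leq_trans (card_fball k2 N) _; rewrite leq_mul2l card_fsphere.
  exact: size_words_ge.
have hB := @lorentz_norm_indicator R _ B.
have hL : lorentz 2 h by apply: le_lt_trans hB _; exact: ltry.
set P := \sum_(n < N) _.
have P0 : 0 <= P by apply: sumr_ge0 => n _; rewrite mulr_ge0 // exprn_ge0 // ltW.
have q0 : 0 < q%:R :> R by rewrite ltr0n; lia.
have convE x : x \in S -> P / q%:R ^+ 2 <= modulus (convolution f h x).
  rewrite in_fsphere => /eqP xN.
  rewrite /convolution (@sum_finite_support _ _ _ B); last first.
    by move=> y yB; rewrite /convolution_term /h /fset_indicator (negPf yB) mulr0.
  have -> : \sum_(y <- B) convolution_term f h x y =
      (\sum_(y <- B) f_ (fg_length (x * y^-1)%g))%:C.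
    rewrite rmorph_sum /= big_seq_cond [RHS]big_seq_cond.
    apply: eq_bigr => y /andP[yB _].
    by rewrite /convolution_term /h /fset_indicator yB mulr1 fE.
  rewrite modulus_real; last by rewrite sumr_ge0.
  apply: (@le_trans _ _ (\sum_(y <- B) \sum_(n < N)
      f_ n * (fg_length (x * y^-1)%g == n)%:R)); last first.
    apply: ler_sum => y _; set l := fg_length _.
    have [lN|lN] := ltnP l N.
      rewrite (bigD1 (Ordinal lN)) //= eqxx mulr1 big1 ?addr0 // => n nl.
      rewrite (_ : (l == n) = false) ?mulr0 //.
      by apply: contraNF nl => /eqP ln; apply/eqP/val_inj.
    rewrite big1 // => n _; rewrite (_ : (l == n) = false) ?mulr0 //.
    by apply/eqP => ln; have := ltn_ord n; rewrite -ln ltnNge lN.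
  rewrite exchange_big /= mulr_suml; apply: ler_sum => n _.
  rewrite -mulr_sumr -natr_sum -mulrA ler_wpM2l //.
  apply: (@le_trans _ _ (q ^ (n./2).-1)%:R); last first.
    by rewrite ler_nat; apply: pairs_ge => //; have := ltn_ord n; lia.
  rewrite ler_pdivrMr ?exprn_gt0 // natrX -exprD -r_sqr -exprM.
  have r1 : 1 <= r.
    rewrite -(ler_pXn2r (n := 2)) ?nnegrE ?(ltW r_gt0) // r_sqr expr1n.
    by rewrite (ler_nat _ 1); lia.
  by apply: ler_weXn2l => //; lia.
(* The weak norm sees strict inequalities, whence the factor 2 in [t] below. *)
have [->|Pn0] := eqVneq P 0.
  by rewrite !mulr_ge0 // exprn_ge0 // ltW.
have {Pn0} Pp : 0 < P by rewrite lt_neqAle eq_sym Pn0.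
have Q0 : 0 < P / q%:R ^+ 2 by rewrite divr_gt0 // exprn_gt0.
pose t := P / q%:R ^+ 2 / 2; have t0 : 0 < t by rewrite divr_gt0.
have S0 : 0 < Num.sqrt #|` S|%:R :> R.
  rewrite sqrtr_gt0 ltr0n card_fsphere; apply: leq_trans (size_words_ge k2 N).
  by rewrite expn_gt0; lia.
have tS : t * Num.sqrt #|` S|%:R <= `|M| * (2 * Num.sqrt #|` B|%:R).
  apply: (@weak_norm_ge _ _ (convolution f h)) => //.
    apply: le_trans (hM h hL) _; rewrite EFinM.
    apply: (@le_trans _ _ (`|M|%:E * lorentz_norm 2 h)%E).
      by apply: lee_wpmul2r; [exact: lorentz_norm_ge0|rewrite lee_fin ler_norm].
    by apply: lee_wpmul2l; rewrite ?lee_fin.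
  by move=> x /convE; apply: lt_le_trans; rewrite /t; lra.
have BS' : Num.sqrt #|` B|%:R <= 2 * Num.sqrt #|` S|%:R :> R.
  rewrite -(ler_pXn2r (n := 2)) ?nnegrE ?sqrtr_ge0 ?mulr_ge0 ?(ltW S0) //.
  rewrite exprMn !sqr_sqrtr //.
  have : #|` B|%:R <= 3 * #|` S|%:R :> R by rewrite -natrM ler_nat.
  have : 0 <= #|` S|%:R :> R by [].
  lra.
have tM : t <= `|M| * 4.
  rewrite -(ler_pM2r S0); apply: le_trans tS _.
  rewrite -mulrA ler_wpM2l //; lra.
move: tM; rewrite /t ler_pdivrMr // ler_pdivrMr ?exprn_gt0 // => H.
by apply: le_trans H _; rewrite le_eqVlt; apply/orP; left; apply/eqP; ring.
Qed.

End Radial.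

Lemma radial_value (R : realType) (k : nat) (f_ : nat -> R)
    (f : free_group k -> R[i]) (x : free_group k) :
    series (fun n => (f_ n)%:C * \1_(sphere n) x : R[i]^o) @ \oo
      --> (f x : R[i]^o) ->
  f x = (f_ (fg_length x))%:C.
Proof.
move=> fx.
have fx' : series (fun n => (f_ n)%:C * \1_(sphere n) x : R[i]^o) @ \oo
    --> ((f_ (fg_length x))%:C : R[i]^o).
  apply: cvg_near_cst; exists (fg_length x).+1 => // N /= xN.
  rewrite /series /= big_mkord (bigD1 (Ordinal xN)) //= big1 ?addr0.
    by rewrite indicE mem_set // mulr1.
  move=> n nx; rewrite indicE memNset ?mulr0 // => /= xn.
  by move/eqP: nx; apply; apply/val_inj.
exact: (cvg_unique (@norm_hausdorff _ (R[i]^o : normedModType R[i])) fx fx').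
Qed.

Theorem theorem3 (R : realType) (k : nat) (hk : (2 <= k)%N)
    (f_ : nat -> R) (f_ge0 : forall n, 0 <= f_ n)
    (f : free_group k -> R[i])
    (fE : forall x : free_group k,
       series (fun n => (f_ n)%:C * \1_(sphere n) x : R[i]^o) @ \oo
         --> (f x : R[i]^o)) :
  restricted_weak_type 2 (convolution_domain f) (convolution f) <-> lorentz 2 f.
Proof.
have fE' x : f x = (f_ (fg_length x))%:C by exact: radial_value.
split=> [/(restricted_series hk f_ge0 fE')|/(lorentz_series hk f_ge0 fE')] [K fK].
  exact: (series_lorentz hk f_ge0 fE' fK).
exact: (series_restricted hk f_ge0 fE' fK).
Qed.
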